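(* Let $u,v\in\mathbf C$ with $\Re u>1$ and $\Re v>1$. Then $$\int_0^1\zeta_1(v,\alpha)\,\zeta_1(u,\alpha)\,d\alpha=\frac{1}{u+v-1}+\int_1^\infty\alpha^{-v}\,\zeta_1(u,\alpha)\,d\alpha+\int_1^\infty\alpha^{-u}\,\zeta_1(v,\alpha)\,d\alpha .$$
   Context: The modified Hurwitz zeta function is $\zeta_1(u,\alpha)=\sum_{m=1}^\infty (m+\alpha)^{-u}$ for $\alpha>0$, $\Re u>1$. *)

(* Defs.v *)
From Stdlib Require Import Reals.
From Coquelicot Require Import Coquelicot.
Local Open Scope C_scope.

Definition Cexp (z : C) : C :=
  RtoC (exp (Re z)) * (cos (Im z), sin (Im z)).

(** Meaningful for [0 < x] only: the principal power [x ^ s], with the real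
    logarithm of [x]. *)
Definition Rcpow (x : R) (s : C) : C := Cexp (s * RtoC (ln x)).

(** The summation index starts at 1, hence [S n]. The description operator
    [iota] returns the sum whenever the series converges, in particular for
    [0 <= alpha] and [1 < Re u]; outside convergence the value is
    unspecified. *)
Definition zeta1 (u : C) (alpha : R) : C :=
  iota (T := C_CompleteNormedModule)
    (is_series (K := C_AbsRing) (V := C_NormedModule)
       (fun n : nat => Rcpow (INR (S n) + alpha)%R (- u))).

(** Riemann integrals of functions of a real variable with values in [C]
    seen as a real normed space; [RInt] and [RInt_gen] are total, so
    convergence is a separate predicate. *)
Definition ex_CRInt (f : R -> C) (a b : R) : Prop :=
  ex_RInt (V := C_R_NormedModule) f a b.

Definition CRInt (f : R -> C) (a b : R) : C :=
  RInt (V := C_R_CompleteNormedModule) f a b.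

Definition ex_CRInt_infty (f : R -> C) (a : R) : Prop :=
  ex_RInt_gen (V := C_R_NormedModule) f (at_point a) (Rbar_locally p_infty).

Definition CRInt_infty (f : R -> C) (a : R) : C :=
  RInt_gen (V := C_R_CompleteNormedModule) f
    (at_point a) (Rbar_locally p_infty).

(* Main.v *)
(** Write [f = zeta1 u], [g = zeta1 v]. The recursion [f(a) = (a+1)^(-u) + f(a+1)] and
    its analogue for [g] give [g f (a) - g f (a+1) = H (a+1)] with
    [H(x) = x^(-u-v) + x^(-v) f(x) + x^(-u) g(x)]. Integrating over [0 <= a <= X-1],
    the integral of [H] over [[1,X]] is the integral of [g f] over [[0,1]] minus that
    over [[X-1,X]], and the latter tends to 0 because [f] and [g] vanish at infinity. *)

Require Import Defs.
From Stdlib Require Import Reals Lra.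
From Coquelicot Require Import Coquelicot.

Local Open Scope R_scope.

(** * Complex powers of a real base: polar form and algebra *)

Lemma Rcpow_polar (x : R) (s : C) :
  Rcpow x s = (Rpower x (Re s) * cos (Im s * ln x), Rpower x (Re s) * sin (Im s * ln x)).
Proof.
  unfold Rcpow, Cexp, Rpower, Cmult, RtoC; simpl. unfold Re, Im.
  replace (fst s * ln x - snd s * 0) with (fst s * ln x) by ring.
  replace (fst s * 0 + snd s * ln x) with (snd s * ln x) by ring.
  f_equal; ring.
Qed.

Lemma Cmod_Rcpow (x : R) (s : C) : Cmod (Rcpow x s) = Rpower x (Re s).
Proof.
  rewrite Rcpow_polar. unfold Cmod; cbn [fst snd].
  generalize (sin2_cos2 (Im s * ln x)); unfold Rsqr; intros E.
  replace (_ + _) with (Rpower x (Re s) * Rpower x (Re s)).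
  - apply sqrt_square. left. apply exp_pos.
  - transitivity (Rpower x (Re s) * Rpower x (Re s) * 1); [ring|]. rewrite <- E. ring.
Qed.

Lemma Rcpow_plus (x : R) (s t : C) : Rcpow x (s + t)%C = (Rcpow x s * Rcpow x t)%C.
Proof.
  rewrite !Rcpow_polar. destruct s as [a b], t as [c d].
  unfold Cmult, Cplus, Re, Im; cbn [fst snd].
  rewrite Rpower_plus, !Rmult_plus_distr_r, cos_plus, sin_plus. f_equal; ring.
Qed.

Lemma Rcpow_1_r (x : R) : 0 < x -> Rcpow x (RtoC 1) = RtoC x.
Proof.
  intros Hx. rewrite Rcpow_polar. unfold Re, Im, RtoC; cbn [fst snd].
  rewrite Rpower_1, Rmult_0_l, cos_0, sin_0 by assumption. f_equal; ring.
Qed.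

Lemma Rcpow_1_l (s : C) : Rcpow 1 s = RtoC 1.
Proof.
  rewrite Rcpow_polar. unfold Rpower, RtoC. rewrite ln_1, !Rmult_0_r, exp_0, cos_0, sin_0.
  f_equal; ring.
Qed.

(** * Modulus and continuity for complex-valued functions *)

Lemma C_R_norm_Cmod (z : C_R_NormedModule) : norm z = Cmod z.
Proof.
  destruct z as [a b]. unfold norm; simpl. unfold prod_norm, Cmod, norm; simpl. unfold abs; simpl.
  rewrite !Rmult_1_r, <- !Rabs_mult, !Rabs_pos_eq by apply Rle_0_sqr. reflexivity.
Qed.

Lemma continuous_C_pair {U : UniformSpace} (f : U -> C) (x : U) :
  continuous (fun t => Re (f t)) x -> continuous (fun t => Im (f t)) x -> continuous f x.
Proof.
  intros H1 H2. apply filterlim_locally. intros eps.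
  specialize (proj1 (filterlim_locally _ _) H1 eps). specialize (proj1 (filterlim_locally _ _) H2 eps).
  intros K2 K1. generalize (filter_and _ _ K1 K2). apply filter_imp. intros t [B1 B2]. split; assumption.
Qed.

Lemma continuous_Re {U : UniformSpace} (f : U -> C) (x : U) :
  continuous f x -> continuous (fun t => Re (f t)) x.
Proof. intros H. apply (continuous_comp f (fst : C -> R)); [exact H|]. apply continuous_fst. Qed.

Lemma continuous_Im {U : UniformSpace} (f : U -> C) (x : U) :
  continuous f x -> continuous (fun t => Im (f t)) x.
Proof. intros H. apply (continuous_comp f (snd : C -> R)); [exact H|]. apply continuous_snd. Qed.

Lemma continuous_Cplus {U : UniformSpace} (f g : U -> C) (x : U) :
  continuous f x -> continuous g x -> continuous (fun t => f t + g t)%C x.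
Proof.
  intros Hf Hg. apply (continuous_plus (V := C_NormedModule) f g x Hf Hg).
Qed.

Lemma continuous_Cmult {U : UniformSpace} (f g : U -> C) (x : U) :
  continuous f x -> continuous g x -> continuous (fun t => f t * g t)%C x.
Proof.
  intros Hf Hg.
  generalize (continuous_Re _ _ Hf) (continuous_Im _ _ Hf) (continuous_Re _ _ Hg) (continuous_Im _ _ Hg).
  intros Rf If Rg Ig. apply continuous_C_pair; unfold Re, Im, Cmult; simpl.
  - apply (continuous_minus (V := R_NormedModule)); apply (continuous_mult (K := R_AbsRing)); assumption.
  - apply (continuous_plus (V := R_NormedModule)); apply (continuous_mult (K := R_AbsRing)); assumption.
Qed.

(** * Calculus of [x ^ s] in the real variable [x] *)

Lemma is_derive_Re_Im_Rcpow (s : C) (x : R) : 0 < x ->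
  is_derive (fun t => Re (Rcpow t s)) x (Re (s * Rcpow x (s - RtoC 1))) /\
  is_derive (fun t => Im (Rcpow t s)) x (Im (s * Rcpow x (s - RtoC 1))).
Proof.
  intros Hx.
  (* Writing [x ^ (s - 1)] as [x ^ s / x] leaves the same exponential, cosine and sine of [ln x] on
     both sides, so that [field] can compare the derivatives. *)
  assert (E : Rcpow x (s - RtoC 1)%C = (Rcpow x s * RtoC (/ x))%C).
  { assert (E1 : Rcpow x s = (Rcpow x (s - RtoC 1) * RtoC x)%C).
    { rewrite <- (Rcpow_1_r x Hx), <- Rcpow_plus. f_equal. ring. }
    rewrite E1, <- Cmult_assoc, <- RtoC_mult, Rinv_r by lra. ring. }
  rewrite E, (Rcpow_polar x). destruct s as [a b].
  split; eapply is_derive_ext; try (intros t; rewrite Rcpow_polar; reflexivity);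
    unfold Re, Im, Rpower, Cmult, RtoC; simpl; auto_derive; try tauto; field; lra.
Qed.

Lemma continuous_Rcpow (s : C) (x : R) : 0 < x -> continuous (fun t => Rcpow t s) x.
Proof.
  intros Hx. destruct (is_derive_Re_Im_Rcpow s x Hx) as [D1 D2].
  apply continuous_C_pair; apply (ex_derive_continuous (V := R_NormedModule)); eexists; eassumption.
Qed.

Lemma is_RInt_Rcpow (s : C) (a b : R) : 0 < a -> a <= b ->
  is_RInt (V := C_R_NormedModule) (fun x => s * Rcpow x (s - RtoC 1))%C a b (Rcpow b s - Rcpow a s)%C.
Proof.
  intros Ha Hab.
  assert (Hc : forall x, Rmin a b <= x <= Rmax a b -> 0 < x).
  { intros x. rewrite Rmin_left by assumption. lra. }
  assert (K : forall x, 0 < x -> continuous (fun x => s * Rcpow x (s - RtoC 1))%C x).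
  { intros x Hx. apply continuous_Cmult; [apply continuous_const | apply continuous_Rcpow, Hx]. }
  apply (is_RInt_fct_extend_pair (U := R_NormedModule) (V := R_NormedModule)).
  - apply (is_RInt_derive (fun x => Re (Rcpow x s)) (fun x => Re (s * Rcpow x (s - RtoC 1)))).
    + intros x Hx. apply is_derive_Re_Im_Rcpow; auto.
    + intros x Hx. apply continuous_Re, K; auto.
  - apply (is_RInt_derive (fun x => Im (Rcpow x s)) (fun x => Im (s * Rcpow x (s - RtoC 1)))).
    + intros x Hx. apply is_derive_Re_Im_Rcpow; auto.
    + intros x Hx. apply continuous_Im, K; auto.
Qed.

(** * Real powers: decay and comparison of sums with integrals *)

Lemma Rpower_decr (x y d : R) : 0 < x -> x <= y -> d <= 0 -> Rpower y d <= Rpower x d.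
Proof.
  intros Hx Hxy Hd. unfold Rpower.
  assert (L : ln x <= ln y) by (destruct Hxy as [H|H]; [left; apply ln_increasing | right; f_equal]; assumption).
  assert (M : d * ln y <= d * ln x) by nra.
  destruct M as [M|M]; [left; apply exp_increasing, M | right; rewrite M; reflexivity].
Qed.

Lemma Rpower_neg_vanish (d eps : R) : d < 0 -> 0 < eps ->
  exists M, 0 < M /\ forall x, M <= x -> Rpower x d < eps.
Proof.
  (* The witness is the point where the power equals [eps / 2]; beyond it the power only
     decreases. *)
  intros Hd Heps. exists (Rpower (eps / 2) (/ d)). split; [apply exp_pos|].
  intros x Hx. apply Rle_lt_trans with (Rpower (Rpower (eps / 2) (/ d)) d).
  - apply Rpower_decr; [apply exp_pos | exact Hx | lra].
  - rewrite Rpower_mult, Rinv_l, Rpower_1; lra.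
Qed.

Lemma is_derive_Rpower (d x : R) : 0 < x -> is_derive (fun t => Rpower t d) x (d * Rpower x (d - 1)).
Proof. intros Hx. apply is_derive_Reals, derivable_pt_lim_power, Hx. Qed.

Lemma is_RInt_Rpower (s a b : R) : 1 < s -> 0 < a -> a <= b ->
  is_RInt (fun x => Rpower x (- s)) a b ((Rpower a (1 - s) - Rpower b (1 - s)) / (s - 1)).
Proof.
  intros Hs Ha Hab.
  assert (Hc : forall x, Rmin a b <= x <= Rmax a b -> 0 < x).
  { intros x. rewrite Rmin_left by assumption. lra. }
  replace (_ / _) with (minus (Rpower b (1 - s) / (1 - s)) (Rpower a (1 - s) / (1 - s)))
    by (unfold minus, plus, opp; simpl; field; lra).
  apply (is_RInt_derive (fun x => Rpower x (1 - s) / (1 - s))).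
  - intros x Hx. replace (Rpower x (- s)) with ((1 - s) * Rpower x (1 - s - 1) * / (1 - s)).
    + apply (is_derive_scal_l (K := R_AbsRing) (V := R_NormedModule)), is_derive_Rpower. auto.
    + replace (1 - s - 1) with (- s) by ring. field. lra.
  - intros x Hx. apply (ex_derive_continuous (V := R_NormedModule)). eexists. apply is_derive_Rpower. auto.
Qed.

(** A decreasing function on [[x, x + 1]] is at least its value at the right end, so that value is
    bounded by the integral, which has a closed form that telescopes. *)
Lemma Rpower_telescope (s x : R) : 1 < s -> 0 < x ->
  Rpower (x + 1) (- s) <= (Rpower x (1 - s) - Rpower (x + 1) (1 - s)) / (s - 1).
Proof.
  intros Hs Hx.
  assert (I := is_RInt_const (V := R_NormedModule) x (x + 1) (Rpower (x + 1) (- s))).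
  replace (scal _ _) with (Rpower (x + 1) (- s)) in I
    by (unfold scal; simpl; unfold mult; simpl; ring).
  refine (is_RInt_le _ _ x (x + 1) _ _ _ I (is_RInt_Rpower s x (x + 1) Hs Hx _) _); try lra.
  intros t Ht. apply Rpower_decr; lra.
Qed.

Lemma sum_Rpower_shift_le (s x : R) (n : nat) : 1 < s -> 0 < x ->
  sum_n (fun k => Rpower (INR (S k) + x) (- s)) n <= Rpower x (1 - s) / (s - 1).
Proof.
  intros Hs Hx.
  (* The subtracted power makes the induction telescope; being positive, it is dropped at the
     end. *)
  assert (H : sum_n (fun k => Rpower (INR (S k) + x) (- s)) n
    <= (Rpower x (1 - s) - Rpower (INR (S n) + x) (1 - s)) / (s - 1)).
  { induction n as [|n IH].
    - rewrite sum_O. replace (INR 1 + x) with (x + 1) by (simpl; ring).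
      apply Rpower_telescope; assumption.
    - rewrite sum_Sn. unfold plus; simpl plus.
      generalize (Rpower_telescope s (INR (S n) + x) Hs ltac:(generalize (pos_INR (S n)); lra)).
      replace (INR (S n) + x + 1) with (INR (S (S n)) + x) by (rewrite (S_INR (S n)); ring).
      intros T. eapply Rle_trans; [apply Rplus_le_compat; eassumption|]. right. field. lra. }
  eapply Rle_trans; [exact H|]. apply Rmult_le_compat_r; [left; apply Rinv_0_lt_compat; lra|].
  generalize (exp_pos ((1 - s) * ln (INR (S n) + x))). unfold Rpower. lra.
Qed.

Lemma ex_series_Rpower_shift (s x : R) : 1 < s -> 0 < x ->
  ex_series (fun k => Rpower (INR (S k) + x) (- s)).
Proof.
  intros Hs Hx.
  destruct (ex_finite_lim_seq_incr (sum_n (fun k => Rpower (INR (S k) + x) (- s)))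
    (Rpower x (1 - s) / (s - 1))) as [l Hl].
  - intros n. rewrite sum_Sn. unfold plus; simpl.
    match goal with |- context [Rpower ?a ?b] => generalize (exp_pos (b * ln a)) end.
    unfold Rpower. simpl. lra.
  - intros n. apply sum_Rpower_shift_le; assumption.
  - exists l. exact Hl.
Qed.

(** * The modified zeta function: convergence, recursion, decay, continuity *)

Lemma is_series_zeta1 (u : C) (a : R) : 1 < Re u -> -1 < a ->
  is_series (K := C_AbsRing) (V := C_NormedModule) (fun n => Rcpow (INR (S n) + a) (- u)) (zeta1 u a).
Proof.
  intros Hu Ha.
  assert (E : ex_series (K := C_AbsRing) (V := C_NormedModule) (fun n => Rcpow (INR (S n) + a) (- u))).
  (* Dropping the first term replaces the shift [a] by [1 + a > 0], where the real comparison series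
     converges. This reaches all [a > -1], hence a full neighbourhood of the endpoint 0 of the
     integral. *)
  { apply (ex_series_incr_1 (K := C_AbsRing) (V := C_NormedModule)).
    apply (ex_series_le (K := C_AbsRing) (V := C_CompleteNormedModule)) with
      (b := fun k => Rpower (INR (S k) + (1 + a)) (- Re u)).
    - intros n. change norm with Cmod. rewrite Cmod_Rcpow, (S_INR (S n)). right.
      change (Re (- u)) with (- Re u). f_equal. ring.
    - apply ex_series_Rpower_shift; lra. }
  destruct E as [l Hl].
  unfold zeta1. rewrite (iota_unique (V := C_CompleteNormedModule) _ l); [exact Hl| |exact Hl].
  intros y Hy. apply (filterlim_locally_unique (V := C_NormedModule) _ _ _ Hy Hl).
Qed.

Lemma zeta1_shift (u : C) (a : R) : 1 < Re u -> -1 < a ->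
  zeta1 u a = (Rcpow (a + 1) (- u) + zeta1 u (a + 1))%C.
Proof.
  intros Hu Ha.
  assert (H : is_series (K := C_AbsRing) (V := C_NormedModule) (fun n => Rcpow (INR (S n) + a) (- u))
    (Rcpow (a + 1) (- u) + zeta1 u (a + 1))%C).
  { apply (is_series_decr_1 (K := C_AbsRing) (V := C_NormedModule)).
    replace (plus _ _) with (zeta1 u (a + 1)).
    - eapply is_series_ext; [|apply is_series_zeta1; lra].
      intros n. cbv beta. f_equal. rewrite (S_INR (S n)). ring.
    - change (INR 1) with 1. rewrite (Rplus_comm 1 a). unfold plus, opp; simpl. ring. }
  apply (filterlim_locally_unique (V := C_NormedModule) _ _ _ (is_series_zeta1 u a Hu Ha) H).
Qed.

(** The triangle inequality reduces each partial sum to the real one, whose bound does not depend on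
    [n] and so passes to the limit. *)
Lemma Cmod_zeta1_le (u : C) (a : R) : 1 < Re u -> 0 < a ->
  Cmod (zeta1 u a) <= Rpower a (1 - Re u) / (Re u - 1).
Proof.
  intros Hu Ha.
  assert (S1 := is_series_zeta1 u a Hu ltac:(lra)).
  assert (L : is_lim_seq (fun n => Cmod (sum_n (G := C_NormedModule) (fun n => Rcpow (INR (S n) + a) (- u)) n))
    (Cmod (zeta1 u a))).
  { exact (filterlim_comp _ _ _ _ _ _ _ _ S1 (filterlim_norm (K := C_AbsRing) (V := C_NormedModule) _)). }
  refine (is_lim_seq_le _ _ _ (Finite _) _ L (is_lim_seq_const _)).
  intros n. eapply Rle_trans; [apply (norm_sum_n_m (K := C_AbsRing) (V := C_NormedModule))|].
  eapply Rle_trans; [|apply (sum_Rpower_shift_le _ _ n Hu Ha)].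
  right. apply sum_n_ext. intros k. change norm with Cmod. apply Cmod_Rcpow.
Qed.

Lemma zeta1_shift_n (u : C) (a : R) (n : nat) : 1 < Re u -> -1 < a ->
  zeta1 u a = (sum_n (G := C_NormedModule) (fun k => Rcpow (INR (S k) + a) (- u)) n
    + zeta1 u (a + INR (S n)))%C.
Proof.
  intros Hu Ha. induction n as [|n IH].
  - rewrite sum_O. change (INR 1) with 1. rewrite (Rplus_comm 1 a). apply zeta1_shift; assumption.
  - rewrite sum_Sn, IH, (zeta1_shift u (a + INR (S n)) Hu) by (generalize (pos_INR (S n)); lra).
    rewrite (S_INR (S n)).
    replace (INR (S n) + 1 + a) with (a + INR (S n) + 1) by ring.
    rewrite (Rplus_assoc a). change plus with Cplus. ring.
Qed.

Lemma Cmod_zeta1_vanish (u : C) (eps : R) : 1 < Re u -> 0 < eps ->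
  exists M, 0 < M /\ forall x, M <= x -> Cmod (zeta1 u x) < eps.
Proof.
  intros Hu Heps.
  destruct (Rpower_neg_vanish (1 - Re u) (eps * (Re u - 1)) ltac:(lra) ltac:(nra)) as [M [HM B]].
  exists M. split; [exact HM|]. intros x Hx.
  eapply Rle_lt_trans; [apply Cmod_zeta1_le; lra|].
  apply Rlt_div_l; [lra|]. apply B, Hx.
Qed.

(* The recursion isolates a finite sum with remainder [zeta1 u (t + n + 1)], which is
   small uniformly in [t > -1]; this replaces a uniform convergence theorem. *)
Lemma continuous_zeta1 (u : C) (a : R) : 1 < Re u -> -1 < a -> continuous (zeta1 u) a.
Proof.
  intros Hu Ha. apply filterlim_locally. intros eps.
  (* One third of [eps] for each of the two remainders, at [t] and at [a], and one for the
     difference of the finite sums. *)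
  destruct (Cmod_zeta1_vanish u (eps / 3) Hu ltac:(generalize (cond_pos eps); lra)) as [M [HM B]].
  destruct (INR_unbounded M) as [n Hn].
  set (P := fun t => sum_n (G := C_NormedModule) (fun k => Rcpow (INR (S k) + t) (- u)) n).
  assert (CS : continuous P a).
  { unfold P. clear P Hn. induction n as [|n IH].
    - apply continuous_ext with (fun t => Rcpow (INR 1 + t) (- u)); [intros t; rewrite sum_O; reflexivity|].
      apply (continuous_comp (fun t => INR 1 + t) (fun y => Rcpow y (- u))).
      + apply (continuous_plus (V := R_NormedModule)); [apply continuous_const | apply continuous_id].
      + apply continuous_Rcpow. simpl. lra.
    - apply continuous_ext with (fun t => sum_n (G := C_NormedModule) (fun k => Rcpow (INR (S k) + t) (- u)) n
        + Rcpow (INR (S (S n)) + t) (- u))%C; [intros t; symmetry;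
        exact (sum_Sn (G := C_NormedModule) (fun k => Rcpow (INR (S k) + t) (- u)) n)|].
      apply continuous_Cplus; [exact IH|].
      apply (continuous_comp (fun t => INR (S (S n)) + t) (fun y => Rcpow y (- u))).
      + apply (continuous_plus (V := R_NormedModule)); [apply continuous_const | apply continuous_id].
      + apply continuous_Rcpow. rewrite S_INR, S_INR. generalize (pos_INR n). lra. }
  assert (E3 : 0 < eps / 3) by (generalize (cond_pos eps); lra).
  (* Balls of the uniform structure on [C] are coordinatewise; norm balls give a bound on [Cmod], to
     which the triangle inequality applies. *)
  generalize (proj1 (filterlim_locally_ball_norm (K := C_AbsRing) (U := C_NormedModule) _ _) CS (mkposreal _ E3)).
  intros L1. assert (L2 : locally a (fun t => -1 < t)) by (apply open_gt, Ha).
  generalize (filter_and _ _ L1 L2). apply filter_imp. intros t [D Ht].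
  apply C_NormedModule_mixin_compat1.
  (* Since [n > M], the extra 1 in [S n] compensates for [t] being as low as -1. *)
  assert (N : forall t, -1 < t -> M <= t + INR (S n)) by (intros t' Ht'; rewrite S_INR; lra).
  rewrite (zeta1_shift_n u t n Hu Ht), (zeta1_shift_n u a n Hu Ha).
  fold (P t) (P a).
  assert (Bt := B _ (N _ Ht)). assert (Ba := B _ (N _ Ha)).
  change (Cmod (P t - P a) < eps / 3) in D.
  set (zt := zeta1 u _) in *. set (za := zeta1 u (a + _)) in *.
  replace (_ - _)%C with (P t - P a + (zt - za))%C by ring.
  assert (T1 := Cmod_triangle (P t - P a) (zt - za)).
  assert (T2 := Cmod_triangle zt (- za)). rewrite Cmod_opp in T2.
  unfold Cminus in *. lra.
Qed.

(** * Improper integrals of complex-valued functions *)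

Lemma filterlim_p_infty_C (F : R -> C) (l : C) :
  (forall eps, 0 < eps -> exists M, forall X, M < X -> Cmod (F X - l) < eps) ->
  filterlim F (Rbar_locally p_infty) (locally l).
Proof.
  intros H. apply filterlim_locally. intros eps.
  destruct (H eps (cond_pos eps)) as [M B]. exists M. intros X HX.
  apply C_NormedModule_mixin_compat1, B, HX.
Qed.

(** The filter [at_point a] pins the lower limit, so the limit over the product filter is a limit in
    the upper limit alone. *)
Lemma is_RInt_gen_p_infty {V : NormedModule R_AbsRing} (f F : R -> V) (a : R) (l : V) :
  (forall X, a <= X -> is_RInt f a X (F X)) ->
  filterlim F (Rbar_locally p_infty) (locally l) ->
  is_RInt_gen f (at_point a) (Rbar_locally p_infty) l.
Proof.
  intros HI HF.
  apply (filterlimi_lim_ext_loc (fun ab => F (snd ab))).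
  - apply (Filter_prod _ _ _ (fun x => x = a) (fun y => a < y)).
    + reflexivity.
    + exists a. auto.
    + intros x y -> Hy. apply HI. simpl. lra.
  - apply (filterlim_comp _ _ _ snd F _ _ _ filterlim_snd HF).
Qed.

Lemma CRInt_Chasles (h : R -> C) (a b c : R) :
  ex_CRInt h a b -> ex_CRInt h b c -> (CRInt h a b + CRInt h b c)%C = CRInt h a c.
Proof. exact (RInt_Chasles (V := C_R_CompleteNormedModule) h a b c). Qed.

(** The majorant is integrated exactly and its contribution at [y] is discarded, which makes the
    bound uniform in [y], as a Cauchy argument requires. *)
Lemma Cmod_CRInt_le (h : R -> C) (x y K s : R) : 1 < s -> 0 < x -> x <= y ->
  (forall t, x <= t <= y -> continuous h t) ->
  (forall t, x <= t <= y -> Cmod (h t) <= K * Rpower t (- s)) ->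
  Cmod (CRInt h x y) <= K * (Rpower x (1 - s) / (s - 1)).
Proof.
  intros Hs Hx Hxy Hc Hb.
  assert (E : ex_RInt (V := C_R_CompleteNormedModule) h x y).
  { apply ex_RInt_continuous. rewrite Rmin_left, Rmax_right by assumption. exact Hc. }
  assert (K0 : 0 <= K).
  { generalize (Rle_trans _ _ _ (Cmod_ge_0 _) (Hb x ltac:(lra))) (exp_pos (- s * ln x)).
    unfold Rpower. intros. nra. }
  apply Rle_trans with (K * ((Rpower x (1 - s) - Rpower y (1 - s)) / (s - 1))).
  - rewrite <- C_R_norm_Cmod.
    apply (norm_RInt_le (V := C_R_NormedModule) h (fun t => K * Rpower t (- s)) x y _ _ Hxy).
    + intros t Ht. rewrite C_R_norm_Cmod. apply Hb, Ht.
    + apply (RInt_correct (V := C_R_CompleteNormedModule)), E.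
    + apply (is_RInt_scal (V := R_NormedModule) (fun t => Rpower t (- s)) x y K), is_RInt_Rpower; assumption.
  - apply Rmult_le_compat_l; [exact K0|]. apply Rmult_le_compat_r; [left; apply Rinv_0_lt_compat; lra|].
    generalize (exp_pos ((1 - s) * ln y)). unfold Rpower. lra.
Qed.

(** Cauchy criterion for the integrals over [[a, X]]: the difference of two of them is an integral
    over [[x, y]], at most [K * x ^ (1 - s) / (s - 1)] in modulus, and this tends to 0 because
    [s > 1]. *)
Lemma ex_CRInt_infty_dominated (h : R -> C) (a K s : R) : 1 < s -> 0 < a ->
  (forall t, a <= t -> continuous h t) ->
  (forall t, a <= t -> Cmod (h t) <= K * Rpower t (- s)) ->
  ex_CRInt_infty h a.
Proof.
  intros Hs Ha Hc Hb.
  assert (E : forall x y, a <= x -> a <= y -> ex_RInt (V := C_R_CompleteNormedModule) h x y).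
  { intros x y Hx Hy. apply ex_RInt_continuous. intros z Hz. apply Hc.
    generalize (Rmin_glb x y a Hx Hy). lra. }
  destruct (proj1 (filterlim_locally_cauchy (U := C_R_CompleteNormedModule) (F := Rbar_locally p_infty)
    (fun X => CRInt h a X))) as [l Hl].
  - intros eps.
    assert (K0 : 0 <= K).
    { generalize (Rle_trans _ _ _ (Cmod_ge_0 _) (Hb a ltac:(lra))) (exp_pos (- s * ln a)).
      unfold Rpower. intros. nra. }
    (* The factor [s - 1] cancels the denominator of the tail bound; [K + 1] replaces [K] to avoid
       dividing by 0. *)
    destruct (Rpower_neg_vanish (1 - s) (eps * (s - 1) / (K + 1)) ltac:(lra)) as [M [HM B]].
    { apply Rdiv_lt_0_compat; [|lra]. apply Rmult_lt_0_compat; [apply cond_pos|lra]. }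
    assert (W : forall x y, a <= x -> M <= x -> x <= y -> Cmod (CRInt h a y - CRInt h a x) < eps).
    { intros x y Hax HMx Hxy.
      replace (CRInt h a y - CRInt h a x)%C with (CRInt h x y).
      - eapply Rle_lt_trans; [apply (Cmod_CRInt_le h x y K s); try lra; intros t Ht; [apply Hc|apply Hb]; lra|].
        specialize (B x HMx). apply Rlt_div_r in B; [|lra].
        assert (P := exp_pos ((1 - s) * ln x)). fold (Rpower x (1 - s)) in P.
        replace (K * (Rpower x (1 - s) / (s - 1))) with (K * Rpower x (1 - s) / (s - 1)) by (field; lra).
        apply Rlt_div_l; lra.
      - rewrite <- (CRInt_Chasles h a x y) by (apply E; lra). ring. }
    exists (fun x => Rmax a M < x). split; [exists (Rmax a M); auto|].
    intros x y Hx Hy. generalize (Rmax_l a M) (Rmax_r a M). intros.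
    (* The Cauchy condition does not order [x] and [y], whereas [W] does; symmetry of balls covers
       the other order. *)
    destruct (Rle_lt_dec x y).
    + apply C_NormedModule_mixin_compat1, W; lra.
    + apply (ball_sym (M := C_UniformSpace)), C_NormedModule_mixin_compat1, W; lra.
  - exists l. apply (is_RInt_gen_p_infty (V := C_R_NormedModule) h (fun X => CRInt h a X) a l); [|exact Hl].
    intros X HX. apply (RInt_correct (V := C_R_CompleteNormedModule)), E; lra.
Qed.

(** [C_R_NormedModule] has real scalars only, so a complex factor is handled on real and imaginary
    parts. *)
Lemma is_RInt_Cmult_l (c : C) (f : R -> C) (a b : R) (l : C) :
  is_RInt (V := C_R_NormedModule) f a b l ->
  is_RInt (V := C_R_NormedModule) (fun x => c * f x)%C a b (c * l)%C.
Proof.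
  intros H.
  assert (H1 := is_RInt_fct_extend_fst (U := R_NormedModule) (V := R_NormedModule) f a b l H).
  assert (H2 := is_RInt_fct_extend_snd (U := R_NormedModule) (V := R_NormedModule) f a b l H).
  apply (is_RInt_fct_extend_pair (U := R_NormedModule) (V := R_NormedModule)).
  - apply (is_RInt_minus (V := R_NormedModule)); apply (is_RInt_scal (V := R_NormedModule)); assumption.
  - apply (is_RInt_plus (V := R_NormedModule)); apply (is_RInt_scal (V := R_NormedModule)); assumption.
Qed.

(** * The three integrands on the half-line from 1 *)

Lemma is_RInt_gen_Rcpow (s : C) : 1 < Re s ->
  is_RInt_gen (V := C_R_NormedModule) (fun x => Rcpow x (- s)) (at_point 1) (Rbar_locally p_infty)
    (RtoC 1 / (s - RtoC 1))%C.
Proof.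
  intros Hs.
  assert (H0 : (s - RtoC 1)%C <> RtoC 0).
  { intros E. apply (f_equal Re) in E. unfold Re in *; simpl in E. lra. }
  assert (H0' : (RtoC 1 - s)%C <> RtoC 0).
  { intros E. apply H0. replace (s - RtoC 1)%C with (- (RtoC 1 - s))%C by ring. rewrite E. ring. }
  (* The antiderivative is [x ^ (1 - s) / (1 - s)]; it vanishes at infinity since [Re (1 - s) < 0],
     and only the value at 1 survives. *)
  apply (is_RInt_gen_p_infty (V := C_R_NormedModule) _
    (fun X => / (RtoC 1 - s) * (Rcpow X (RtoC 1 - s) - Rcpow 1 (RtoC 1 - s)))%C).
  - intros X HX.
    apply (is_RInt_ext (V := C_R_NormedModule)
      (fun x => / (RtoC 1 - s) * ((RtoC 1 - s) * Rcpow x (RtoC 1 - s - RtoC 1)))%C).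
    + intros x _. rewrite Cmult_assoc, Cinv_l, Cmult_1_l by assumption. f_equal. ring.
    + apply is_RInt_Cmult_l, is_RInt_Rcpow; lra.
  - apply filterlim_p_infty_C. intros eps Heps.
    assert (Hr := proj1 (Cmod_gt_0 _) H0').
    destruct (Rpower_neg_vanish (1 - Re s) (eps * Cmod (RtoC 1 - s)) ltac:(lra)
      ltac:(apply Rmult_lt_0_compat; lra)) as [M [_ B]].
    exists M. intros X HX.
    replace (_ - _)%C with (/ (RtoC 1 - s) * Rcpow X (RtoC 1 - s))%C.
    + rewrite Cmod_mult, Cmod_inv, Cmod_Rcpow by assumption.
      change (Re (RtoC 1 - s)) with (1 - Re s).
      rewrite Rmult_comm. apply Rlt_div_l; [exact Hr|]. apply B. lra.
    + rewrite Rcpow_1_l. field. split; assumption.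
Qed.

(** For [x >= 1] the factor [x ^ (1 - Re u)] in the bound on [zeta1 u x] is at most 1, so a constant
    bounds [zeta1 u] and the power of [x] supplies an integrable majorant. *)
Lemma Cmod_power_zeta1_le (u v : C) (x : R) : 1 < Re u -> 1 <= x ->
  Cmod (Rcpow x (- v) * zeta1 u x) <= / (Re u - 1) * Rpower x (- Re v).
Proof.
  intros Hu Hx. rewrite Cmod_mult, Cmod_Rcpow, Rmult_comm.
  apply Rmult_le_compat_r; [left; apply exp_pos|].
  eapply Rle_trans; [apply Cmod_zeta1_le; lra|].
  unfold Rdiv. rewrite <- (Rmult_1_l (/ (Re u - 1))) at 2.
  apply Rmult_le_compat_r; [left; apply Rinv_0_lt_compat; lra|].
  replace 1 with (Rpower 1 (1 - Re u)) at 2 by (unfold Rpower; rewrite ln_1, Rmult_0_r; apply exp_0).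
  apply Rpower_decr; lra.
Qed.

Lemma continuous_power_zeta1 (u v : C) (x : R) : 1 < Re u -> 0 < x ->
  continuous (fun t => Rcpow t (- v) * zeta1 u t)%C x.
Proof.
  intros Hu Hx. apply continuous_Cmult; [apply continuous_Rcpow | apply continuous_zeta1]; lra.
Qed.

Lemma ex_CRInt_infty_power_zeta1 (u v : C) : 1 < Re u -> 1 < Re v ->
  ex_CRInt_infty (fun t => Rcpow t (- v) * zeta1 u t)%C 1.
Proof.
  intros Hu Hv. apply (ex_CRInt_infty_dominated _ 1 (/ (Re u - 1)) (Re v)); try lra.
  - intros t Ht. apply continuous_power_zeta1; lra.
  - intros t Ht. apply Cmod_power_zeta1_le; lra.
Qed.

(** * The shift identity for the product and its integration *)

Lemma zeta1_product_shift (u v : C) (a : R) : 1 < Re u -> 1 < Re v -> -1 < a ->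
  (zeta1 v a * zeta1 u a = zeta1 v (a + 1) * zeta1 u (a + 1)
    + (Rcpow (a + 1) (- (u + v)) + Rcpow (a + 1) (- v) * zeta1 u (a + 1)
       + Rcpow (a + 1) (- u) * zeta1 v (a + 1)))%C.
Proof.
  intros Hu Hv Ha. rewrite (zeta1_shift u a Hu Ha), (zeta1_shift v a Hv Ha).
  replace (- (u + v))%C with (- u + - v)%C by ring. rewrite Rcpow_plus. ring.
Qed.

(** The increment is treated as a single integrand here; the splitting into three convergent
    integrals is left to the theorem. *)
Lemma is_RInt_gen_zeta1_increments (u v : C) : 1 < Re u -> 1 < Re v ->
  is_RInt_gen (V := C_R_NormedModule)
    (fun x => Rcpow x (- (u + v)) + Rcpow x (- v) * zeta1 u x + Rcpow x (- u) * zeta1 v x)%C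
    (at_point 1) (Rbar_locally p_infty)
    (CRInt (fun a => zeta1 v a * zeta1 u a)%C 0 1).
Proof.
  intros Hu Hv.
  set (P := fun a => (zeta1 v a * zeta1 u a)%C).
  set (H := fun x => (_ + _ + _)%C).
  assert (EP : forall x y, 0 <= x -> 0 <= y -> ex_RInt (V := C_R_CompleteNormedModule) P x y).
  { intros x y Hx Hy. apply ex_RInt_continuous. intros z Hz.
    apply continuous_Cmult; apply continuous_zeta1; generalize (Rmin_glb x y 0 Hx Hy); lra. }
  assert (EH : forall x y, 1 <= x -> 1 <= y -> ex_RInt (V := C_R_CompleteNormedModule) H x y).
  { intros x y Hx Hy. apply ex_RInt_continuous. intros z Hz.
    assert (0 < z) by (generalize (Rmin_glb x y 1 Hx Hy); lra).
    unfold H. apply continuous_Cplus; [apply continuous_Cplus|].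
    - apply continuous_Rcpow; assumption.
    - apply continuous_power_zeta1; assumption.
    - apply continuous_power_zeta1; assumption. }
  assert (Main : forall X, 1 <= X -> CRInt H 1 X = (CRInt P 0 1 - CRInt P (X - 1) X)%C).
  (* The shift identity integrated over [[0, X - 1]], with the substitution [x = a + 1]. The map is
     spelled [1 * a + 1] and the factor [scal 1] kept to match the linear change of variables. *)
  { intros X HX.
    assert (T : CRInt P 0 (X - 1) = (CRInt P 1 X + CRInt H 1 X)%C).
    { apply (is_RInt_unique (V := C_R_CompleteNormedModule)).
      apply (is_RInt_ext (V := C_R_NormedModule) (fun a => scal 1 (plus (P (1 * a + 1)) (H (1 * a + 1))))).
      - intros a. rewrite Rmin_left by lra. intros Ha.
        rewrite (scal_one (V := C_R_NormedModule)), Rmult_1_l.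
        exact (eq_sym (zeta1_product_shift u v a Hu Hv ltac:(lra))).
      - apply (is_RInt_comp_lin (V := C_R_NormedModule) (fun x => plus (P x) (H x)) 1 1 0 (X - 1)).
        replace (1 * 0 + 1) with 1 by ring. replace (1 * (X - 1) + 1) with X by ring.
        apply (is_RInt_plus (V := C_R_NormedModule));
          apply (RInt_correct (V := C_R_CompleteNormedModule)); [apply EP | apply EH]; lra. }
    (* The integral of [P] over [[0, X]] is split both at 1 and at [X - 1]; after inserting [T], the
       part over [[1, X]] cancels. *)
    assert (C1 := CRInt_Chasles P 0 1 X (EP 0 1 ltac:(lra) ltac:(lra)) (EP 1 X ltac:(lra) ltac:(lra))).
    rewrite <- (CRInt_Chasles P 0 (X - 1) X), T in C1 by (apply EP; lra).
    replace (CRInt H 1 X) with (CRInt P 1 X + CRInt H 1 X + CRInt P (X - 1) X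
      - CRInt P 1 X - CRInt P (X - 1) X)%C by ring.
    rewrite <- C1. ring. }
  apply (is_RInt_gen_p_infty (V := C_R_NormedModule) _ (CRInt H 1)).
  { intros X HX. apply (RInt_correct (V := C_R_CompleteNormedModule)), EH; lra. }
  apply filterlim_p_infty_C. intros eps Heps.
  (* With one factor below 1 and the other below [eps / 2], the product is at most [eps / 2] on
     [[X - 1, X]], an interval of length 1. *)
  destruct (Cmod_zeta1_vanish u 1 Hu Rlt_0_1) as [M1 [HM1 B1]].
  destruct (Cmod_zeta1_vanish v (eps / 2) Hv ltac:(lra)) as [M2 [HM2 B2]].
  (* The added 1 puts all of [[X - 1, X]] beyond both thresholds; as these are positive, also
     [X > 1], so [Main] applies. *)
  exists (Rmax M1 M2 + 1). intros X HX. generalize (Rmax_l M1 M2) (Rmax_r M1 M2). intros.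
  rewrite Main by lra.
  replace (_ - _)%C with (- CRInt P (X - 1) X)%C by ring.
  (* The integral estimate is not strict, hence the margin between [eps / 2] and [eps]. *)
  rewrite Cmod_opp. apply Rle_lt_trans with (eps / 2); [|lra].
  assert (I := is_RInt_const (V := R_NormedModule) (X - 1) X (eps / 2)).
  replace (scal _ _) with (eps / 2) in I by (unfold scal; simpl; unfold mult; simpl; ring).
  rewrite <- C_R_norm_Cmod.
  refine (norm_RInt_le (V := C_R_NormedModule) P (fun _ => eps / 2) (X - 1) X _ _ _ _ _ I); [lra| |].
  - intros x Hx. rewrite C_R_norm_Cmod. unfold P. rewrite Cmod_mult.
    specialize (B1 x ltac:(lra)). specialize (B2 x ltac:(lra)).
    generalize (Cmod_ge_0 (zeta1 u x)) (Cmod_ge_0 (zeta1 v x)). intros. nra.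
  - apply (RInt_correct (V := C_R_CompleteNormedModule)), EP; lra.
Qed.

Local Open Scope C_scope.

Theorem lemma4 (u v : C) (hu : (1 < Re u)%R) (hv : (1 < Re v)%R) :
  ex_CRInt (fun alpha : R => zeta1 v alpha * zeta1 u alpha) 0 1 /\
  ex_CRInt_infty (fun alpha : R => Rcpow alpha (- v) * zeta1 u alpha) 1 /\
  ex_CRInt_infty (fun alpha : R => Rcpow alpha (- u) * zeta1 v alpha) 1 /\
  CRInt (fun alpha : R => zeta1 v alpha * zeta1 u alpha) 0 1 =
    RtoC 1 / (u + v - RtoC 1)
    + CRInt_infty (fun alpha : R => Rcpow alpha (- v) * zeta1 u alpha) 1
    + CRInt_infty (fun alpha : R => Rcpow alpha (- u) * zeta1 v alpha) 1.
Proof.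
  assert (E1 := ex_CRInt_infty_power_zeta1 u v hu hv).
  assert (E2 := ex_CRInt_infty_power_zeta1 v u hv hu).
  split; [|split; [exact E1 | split; [exact E2|]]].
  - apply (ex_RInt_continuous (V := C_R_CompleteNormedModule)). intros z Hz.
    rewrite Rmin_left in Hz by lra.
    apply continuous_Cmult; apply continuous_zeta1; lra.
  - assert (Huv : (1 < Re (u + v))%R) by (unfold Re in *; simpl; lra).
    assert (I1 := RInt_gen_correct (V := C_R_CompleteNormedModule) _ E1).
    assert (I2 := RInt_gen_correct (V := C_R_CompleteNormedModule) _ E2).
    assert (I := is_RInt_gen_plus (V := C_R_NormedModule) _ _ _ _
      (is_RInt_gen_plus (V := C_R_NormedModule) _ _ _ _ (is_RInt_gen_Rcpow _ Huv) I1) I2).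
    (* Both sides are values of one improper integral, that of the whole increment: on the left by
       the telescoped form, on the right by adding the three integrals in [I]. *)
    rewrite <- (is_RInt_gen_unique (V := C_R_CompleteNormedModule) _ _ (is_RInt_gen_zeta1_increments u v hu hv)).
    exact (is_RInt_gen_unique (V := C_R_CompleteNormedModule) _ _ I).
Qed.
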